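(* Let $\mathfrak{B}$ be a bornology with a closed base on a topological space $X$. The following are equivalent. (1) $X$ satisfies $S_{fin}(\mathcal{O}_{\mathfrak{B}},\mathcal{O}^{gp}_{\mathfrak{B}})$. (2) ONE does not have a winning strategy in the game $G_{fin}(\mathcal{O}_{\mathfrak{B}},\mathcal{O}^{gp}_{\mathfrak{B}})$ on $X$.
   Context: A bornology $\mathfrak{B}$ on $X$ is a family of subsets of $X$ that is closed under taking subsets and finite unions and covers $X$; by standing convention $X\notin\mathfrak{B}$. A base of $\mathfrak{B}$ is a subfamily $\mathfrak{B}_0\subseteq\mathfrak{B}$ such that every $B\in\mathfrak{B}$ is contained in some $B_0\in\mathfrak{B}_0$; it is closed if its members are closed subsets of $X$. $\mathcal{O}_{\mathfrak{B}}$ is the collection of all open $\mathfrak{B}$-covers of $X$: families $\mathcal{U}$ of open subsets of $X$ with $X\notin\mathcal{U}$ such that every $B\in\mathfrak{B}$ is contained in some $U\in\mathcal{U}$. An open cover $\mathcal{U}$ of $X$ is $\mathfrak{B}$-groupable if $\mathcal{U}=\bigcup_{n\in\omega}\mathcal{U}_n$, where the $\mathcal{U}_n$ are pairwise disjoint finite subsets of $\mathcal{U}$ and for every $B\in\mathfrak{B}$ there is $n_0$ such that for all $n\ge n_0$ we have $B\subseteq U$ for some $U\in\mathcal{U}_n$. $\mathcal{O}^{gp}_{\mathfrak{B}}$ is the collection of all open $\mathfrak{B}$-groupable covers of $X$. $S_{fin}(\mathcal{A},\mathcal{B})$ means that for each sequence $\{\mathcal{U}_n:n\in\omega\}$ of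 elements of $\mathcal{A}$ there are finite (possibly empty) $\mathcal{V}_n\subseteq\mathcal{U}_n$ with $\bigcup_{n\in\omega}\mathcal{V}_n\in\mathcal{B}$. In the game $G_{fin}(\mathcal{A},\mathcal{B})$ two players ONE and TWO play a round for each $n\in\omega$; in round $n$ ONE chooses $\mathcal{U}_n\in\mathcal{A}$ and TWO responds with a finite (possibly empty) $\mathcal{V}_n\subseteq\mathcal{U}_n$. TWO wins the play if $\bigcup_{n\in\omega}\mathcal{V}_n\in\mathcal{B}$; otherwise ONE wins. *)

(* Defs.v *)
From mathcomp Require Import all_boot all_classical.
From mathcomp Require Import topology_structure.

Set Implicit Arguments.
Unset Strict Implicit.
Unset Printing Implicit Defensive.

Local Open Scope classical_set_scope.

Record bornology (X : Type) (B : set (set X)) : Prop := Bornology {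
  born_sub : forall A C, A `<=` C -> B C -> B A;
  born_setU : forall A C, B A -> B C -> B (A `|` C);
  born_cover : \bigcup_(A in B) A = [set: X];
  born_proper : ~ B [set: X]
}.

Definition born_base (X : Type) (B B0 : set (set X)) : Prop :=
  B0 `<=` B /\ forall A, B A -> exists2 A0, B0 A0 & A `<=` A0.

Definition has_closed_base (X : topologicalType) (B : set (set X)) : Prop :=
  exists2 B0, born_base B B0 & forall A, B0 A -> closed A.

Definition born_open_cover (X : topologicalType) (B : set (set X)) :
    set (set (set X)) :=
  [set U | [/\ forall O, U O -> open O,
               ~ U [set: X] &
               forall A, B A -> exists2 O, U O & A `<=` O]].

(* The groups may be empty. *)
Definition groupable (X : Type) (B U : set (set X)) : Prop :=
  exists G : nat -> set (set X),
    [/\ U = \bigcup_n G n,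
        forall n, finite_set (G n),
        trivIset [set: nat] G &
        forall A, B A -> exists n0, forall n, (n0 <= n)%N ->
          exists2 O, G n O & A `<=` O].

Definition born_groupable_cover (X : topologicalType) (B : set (set X)) :
    set (set (set X)) :=
  [set U | [/\ forall O, U O -> open O,
               \bigcup_(O in U) O = [set: X] &
               groupable B U]].

Definition S_fin (T : Type) (A B : set (set T)) : Prop :=
  forall U : nat -> set T, (forall n, A (U n)) ->
    exists V : nat -> set T,
      (forall n, finite_set (V n) /\ V n `<=` U n) /\ B (\bigcup_n V n).

(* A strategy of ONE in G_fin maps the list of the previous answers of TWO,
   oldest first, to ONE's next move; ONE's own previous moves are determined by
   these answers and by the strategy itself. *)
Definition strategy (T : Type) : Type := seq (set T) -> set T.

Definition one_move (T : Type) (s : strategy T) (V : nat -> set T) (n : nat) :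
  set T := s (mkseq V n).

Definition legal_answers (T : Type) (s : strategy T) (V : nat -> set T) : Prop :=
  forall n, finite_set (V n) /\ V n `<=` one_move s V n.

(* ONE's moves have to be legal only in the positions that occur in a play
   following the strategy. *)
Definition winning_for_one (T : Type) (A B : set (set T)) (s : strategy T) :
    Prop :=
  forall V, legal_answers s V ->
    (forall n, A (one_move s V n)) /\ ~ B (\bigcup_n V n).

Definition one_wins_G_fin (T : Type) (A B : set (set T)) : Prop :=
  exists s : strategy T, winning_for_one A B s.

(* Main.v *)
Require Import Defs.
From mathcomp Require Import all_boot all_classical.
From mathcomp Require Import topology_structure.

(** The game can be won against a fixed strategy of ONE because the selection
    principle already yields a uniform, Hurewicz-like form of itself
    ([S_fin_eventually_swallows]): from covers U_0, U_1, ... one can select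
    finite V_n in U_n such that every bounded set lies in a member of V_n for
    all but finitely many n. To get it, select from the covers that refine
    U_0, ..., U_n simultaneously. The groups of the resulting cover are finite
    and disjoint, so a late group avoids everything selected in the first n
    rounds, and hence all of it refines U_n.

    Applied to a constant sequence this principle writes a subcover of any cover
    as an increasing union of finite sets ([exhaustion_exists]). If TWO only
    answers with terms of such exhaustions, then the positions of the game form
    a countable tree indexed by [seq nat]. The principle, applied once to the
    countably many covers that ONE plays in this tree, gives a number g(p) for
    each position p such that every bounded set is contained in a member of the
    g(p)-th term at p, for all but finitely many p. TWO follows the branch that
    g prescribes; it meets each position once, so every bounded set is
    eventually swallowed by TWO's answers.

    The answers themselves serve as groups as soon as they are disjoint. So
    TWO discards from ONE's cover the sets already selected. What remains is
    still a cover: no member of a cover is the whole space, so finitely many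
    extra points make a bounded set that no discarded set contains. *)

Set Implicit Arguments.
Unset Strict Implicit.
Unset Printing Implicit Defensive.

Local Open Scope classical_set_scope.

(** This is the last condition of [groupable], for a sequence that need not be
    disjoint. *)
Definition eventually_swallows (X : Type) (B : set (set X))
    (V : nat -> set (set X)) : Prop :=
  forall A, B A -> exists n0, forall n, (n0 <= n)%N ->
    exists2 O, V n O & A `<=` O.

(** * Removing finitely many members of a cover *)

Lemma bornology_set1 (X : Type) (B : set (set X)) (x : X) :
  bornology B -> B [set x].
Proof.
move=> hB; have : [set: X] x by [].
rewrite -(born_cover hB) => -[A BA Ax].
by apply: (born_sub hB _ BA) => _ ->.
Qed.

(** Each member of [K] misses a point, and adding such a point to [A] for each
    of the finitely many members keeps the set bounded. *)
Lemma bornology_escape (X : Type) (B K : set (set X)) (A : set X) :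
  bornology B -> finite_set K -> ~ K [set: X] -> B A ->
  exists2 A', B A' & A `<=` A' /\ forall O, K O -> ~ A' `<=` O.
Proof.
move=> hB /finite_seqP[s ->] {K}; elim: s => [|O s IHs] nKX BA.
  by exists A => //; split.
have nsX : ~ [set` s] [set: X].
  by move=> sX; apply: nKX; rewrite /= inE; apply/orP; right.
have [A' BA' [AA' escA']] := IHs nsX BA.
have [x nOx] : exists x, ~ O x.
  apply/existsNP => OX; apply: nKX; rewrite /= inE.
  by apply/orP; left; apply/eqP; rewrite eqEsubset; split.
exists (A' `|` [set x]); first exact: (born_setU hB BA' (bornology_set1 x hB)).
split=> [y /AA' A'y|P]; first by left.
rewrite /= inE => /orP[/eqP -> /(_ x)|sP sub].
  by move=> /(_ (or_intror erefl)).
by apply: (escA' P) => // y A'y; apply: sub; left.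
Qed.

Lemma born_open_cover_setD (X : topologicalType) (B U K : set (set X)) :
  bornology B -> finite_set K -> born_open_cover B U ->
  born_open_cover B (U `\` K).
Proof.
move=> hB finK [openU nUX covU].
split=> [O [/openU]|[/nUX]|A BA] //.
have finUK : finite_set (U `&` K) by apply: finite_setIr.
have [|A' BA' [AA' escA']] := bornology_escape hB finUK _ BA.
  by move=> [/nUX].
have [O UO A'O] := covU _ BA'; exists O; last exact: subset_trans A'O.
by split=> // KO; apply: (escA' O).
Qed.

(** * From groupable selections to uniform selections *)

Lemma trivIset_eventually_avoids (T : choiceType) (G : nat -> set T)
    (K : set T) :
  trivIset [set: nat] G -> finite_set K ->
  exists m0, forall m, (m0 <= m)%N -> G m `&` K = set0.
Proof.
move=> trivG /finite_seqP[s ->] {K}; elim: s => [|x s [m0 avoid]].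
  by exists 0 => m _; rewrite set_nil setI0.
have [[k Gkx]|nGx] := pselect (exists k, G k x); last first.
  exists m0 => m m0m; rewrite -subset0 => y [Gy].
  rewrite /= inE => /orP[/eqP yx|sy].
    by apply: nGx; exists m; rewrite -yx.
  by have := avoid m m0m; rewrite -subset0 => /(_ y); apply.
exists (maxn m0 k.+1) => m; rewrite geq_max => /andP[m0m km].
rewrite -subset0 => y [Gy]; rewrite /= inE => /orP[/eqP yx|sy].
  have mk : m = k by apply: trivG => //; exists x; split=> //; rewrite -yx.
  by rewrite mk ltnn in km.
by have := avoid m m0m; rewrite -subset0 => /(_ y); apply.
Qed.

(** Taking all open sets that refine the given covers, instead of the
    intersections of their members, spares the bookkeeping of the factors. *)
Definition common_refinement (X : topologicalType)
    (U : nat -> set (set X)) (n : nat) : set (set X) :=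
  [set O | open O /\ forall k, (k <= n)%N -> exists2 P, U k P & O `<=` P].

Lemma born_open_cover_common_refinement (X : topologicalType)
    (B : set (set X)) (U : nat -> set (set X)) (n : nat) :
  (forall k, born_open_cover B (U k)) ->
  born_open_cover B (common_refinement U n).
Proof.
move=> covU; split=> [O []|[_ /(_ 0 (leq0n n))[P UP XP]]|A BA] //.
  case: (covU 0) => _ + _; apply; suff <- : P = [set: X] by [].
  by rewrite eqEsubset; split.
elim: n => [|n [O [openO refO] AO]].
  case: (covU 0) => openU _ /(_ A BA)[O UO AO]; exists O => //.
  split=> [|k]; first exact: openU.
  by rewrite leqn0 => /eqP ->; exists O.
case: (covU n.+1) => openU _ /(_ A BA)[P UP AP].
exists (O `&` P); last by move=> x Ax; split; [exact: AO|exact: AP].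
split=> [|k]; first by apply: openI => //; exact: openU.
rewrite leq_eqVlt => /orP[/eqP ->|/refO[Q UQ OQ]].
  by exists P => // x [].
by exists Q => // x [/OQ].
Qed.

(** A group disjoint from the selections of the rounds before [n] consists of
    members of later common refinements, so each of its members can be
    enlarged to a member of [U n]. *)
Lemma S_fin_eventually_swallows (X : topologicalType) (B : set (set X))
    (U : nat -> set (set X)) :
  S_fin (born_open_cover B) (born_groupable_cover B) ->
  (forall n, born_open_cover B (U n)) ->
  exists V : nat -> set (set X),
    (forall n, finite_set (V n) /\ V n `<=` U n) /\ eventually_swallows B V.
Proof.
move=> selB covU.
have [W [WP [_ _ [G [WG finG trivG swG]]]]] :=
  selB _ (fun n => born_open_cover_common_refinement n covU).
have late n : exists m, (n <= m)%N /\
    forall O, G m O -> exists2 P, U n P & O `<=` P.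
  have finWn : finite_set (\bigcup_(j in `I_n) W j).
    by apply: bigcup_finite => [|j _]; [exact: finite_II|case: (WP j)].
  have [m0 avoid] := trivIset_eventually_avoids trivG finWn.
  exists (maxn n m0); split=> [|O GO]; first exact: leq_maxl.
  have : (\bigcup_j W j) O by rewrite WG; exists (maxn n m0).
  case=> j _ WO; have [_ /(_ O WO)[_ refO]] := WP j.
  apply: refO; rewrite leqNgt; apply/negP => jn.
  have : (G (maxn n m0) `&` \bigcup_(j in `I_n) W j) O by split=> //; exists j.
  by rewrite avoid ?leq_maxr.
have [m mP] := choice late.
have enlarge n O : exists P, G (m n) O -> U n P /\ O `<=` P.
  have [GO|nGO] := pselect (G (m n) O); last by exists O.
  by have [P UP OP] := (mP n).2 O GO; exists P.
have [h hP] := choice (fun nO => enlarge nO.1 nO.2).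
exists (fun n => (fun O => h (n, O)) @` G (m n)); split=> [n|A BA].
  by split=> [|_ [O GO <-]]; [exact: finite_image|case: (hP (n, O) GO)].
have [n0 sw] := swG A BA; exists n0 => n n0n.
have [O GO AO] := sw (m n) (leq_trans n0n (mP n).1).
exists (h (n, O)); first by exists O.
by case: (hP (n, O) GO) => _; apply: subset_trans.
Qed.

Definition exhaustion (X : topologicalType) (B U : set (set X))
    (F : nat -> set (set X)) : Prop :=
  [/\ forall k, finite_set (F k), {homo F : k l / (k <= l)%N >-> k `<=` l},
      \bigcup_k F k `<=` U & born_open_cover B (\bigcup_k F k)].

Lemma exhaustion_exists (X : topologicalType) (B U : set (set X)) :
  S_fin (born_open_cover B) (born_groupable_cover B) ->
  born_open_cover B U -> exists F, exhaustion B U F.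
Proof.
move=> selB covU.
have [V [VP swV]] := S_fin_eventually_swallows selB (fun=> covU).
exists (fun k => \bigcup_(j in `I_k) V j).
have subU : \bigcup_k \bigcup_(j in `I_k) V j `<=` U.
  by move=> O [k _ [j _ /(VP j).2]].
split=> // [k|k l kl O [j jk VO]|].
- by apply: bigcup_finite => [|j _]; [exact: finite_II|case: (VP j)].
- by exists j => //; apply: leq_trans kl.
case: covU => openU nUX _; split=> [O /subU/openU|/subU|A /swV[n0 sw]] //.
have [O VO AO] := sw n0 (leqnn n0); exists O => //.
by exists n0.+1 => //; exists n0 => //=.
Qed.

Lemma exhaustion_finite_sub (X : topologicalType) (B U K : set (set X))
    (F : nat -> set (set X)) :
  exhaustion B U F -> finite_set K -> K `<=` \bigcup_k F k ->
  exists k, K `<=` F k.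
Proof.
move=> [_ monoF _ _] /finite_seqP[s ->] {K}; elim: s => [|O s IHs] sub.
  by exists 0.
have [|k sk] := IHs.
  by move=> P sP; apply: sub; rewrite /= inE; apply/orP; right.
have [|l _ Fl] := sub O; first by rewrite /= mem_head.
exists (maxn k l) => P; rewrite /= inE => /orP[/eqP ->|/sk].
  exact: (monoF l _ (leq_maxr k l)).
exact: (monoF k _ (leq_maxl k l)).
Qed.

(** * Playing against a strategy of ONE *)

Definition used (T : Type) (p : seq (set T)) : set T :=
  \bigcup_(i in `I_(size p)) nth set0 p i.

Definition fresh_move (T : Type) (s : strategy T) (p : seq (set T)) : set T :=
  s p `\` used p.

Definition legal_position (T : Type) (s : strategy T) (p : seq (set T)) :
    Prop :=
  forall i, (i < size p)%N ->
    finite_set (nth set0 p i) /\ nth set0 p i `<=` s (take i p).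

Lemma finite_used (T : Type) (s : strategy T) (p : seq (set T)) :
  legal_position s p -> finite_set (used p).
Proof.
by move=> legp; apply: bigcup_finite => [|i /legp[]] //; exact: finite_II.
Qed.

Lemma legal_position_rcons (T : Type) (s : strategy T) (p : seq (set T))
    (W : set T) :
  legal_position s p -> finite_set W -> W `<=` s p ->
  legal_position s (rcons p W).
Proof.
move=> legp finW Wsub i; rewrite size_rcons ltnS leq_eqVlt nth_rcons -cats1.
move=> /orP[/eqP ->|ip]; first by rewrite ltnn eqxx take_size_cat.
by rewrite ip takel_cat ?(ltnW ip) //; exact: legp.
Qed.

(** A legal position continues to a full play in which TWO answers with the
    empty set from there on. *)
Lemma winning_for_one_move (T : Type) (A B : set (set T)) (s : strategy T)
    (p : seq (set T)) :
  winning_for_one A B s -> legal_position s p -> A (s p).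
Proof.
move=> winS legp.
have mkseqE i : (i <= size p)%N -> mkseq (nth set0 p) i = take i p.
  move=> ip; apply: (@eq_from_nth _ set0) => [|j].
    by rewrite size_mkseq size_takel.
  by rewrite size_mkseq => ji; rewrite nth_mkseq // nth_take.
have [|+ _] := winS (nth set0 p).
  move=> i; rewrite /one_move; have [ip|pi] := ltnP i (size p).
    by rewrite mkseqE ?(ltnW ip) //; exact: legp.
  by rewrite nth_default //; split=> [|x []]; exact: finite_set0.
by move=> /(_ (size p)); rewrite /one_move mkseqE // take_size.
Qed.

(** The position reached when TWO answers with the terms of the exhaustions [F]
    whose indices are listed, oldest first. *)
Definition position (T : Type) (s : strategy T)
    (F : set T -> nat -> set T) : seq nat -> seq (set T) :=
  foldl (fun p k => rcons p (F (fresh_move s p) k)) [::].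

Lemma position_rcons (T : Type) (s : strategy T) (F : set T -> nat -> set T)
    (t : seq nat) (k : nat) :
  position s F (rcons t k) =
  rcons (position s F t) (F (fresh_move s (position s F t)) k).
Proof. by rewrite /position foldl_rcons. Qed.

Lemma legal_positionP (T : Type) (s : strategy T) (F : set T -> nat -> set T) :
  (forall p, legal_position s p ->
    forall k, finite_set (F (fresh_move s p) k) /\
              F (fresh_move s p) k `<=` fresh_move s p) ->
  forall t, legal_position s (position s F t).
Proof.
move=> FP; elim/last_ind => [|t k legt]; first by move=> i.
have [finF subF] := FP _ legt k.
by rewrite position_rcons; apply: legal_position_rcons => // x /subF[].
Qed.

(** The indices along the branch on which TWO answers with term [g t] in the
    position indexed by [t]. *)
Definition branch (g : seq nat -> nat) (n : nat) : seq nat :=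
  iter n (fun t => rcons t (g t)) [::].

Lemma size_branch (g : seq nat -> nat) (n : nat) : size (branch g n) = n.
Proof. by elim: n => //= n IHn; rewrite size_rcons IHn. Qed.

(** A branch leaves every finite set of codes of positions, because its
    positions are pairwise distinct. *)
Lemma branch_pickle_eventually (g : seq nat -> nat) (k0 : nat) :
  exists n0, forall n, (n0 <= n)%N -> (k0 <= pickle (branch g n))%N.
Proof.
have [n0 avoid] : exists m0, forall m, (m0 <= m)%N ->
    [set pickle (branch g m)] `&` `I_k0 = set0.
  apply: trivIset_eventually_avoids; last exact: finite_II.
  move=> i j _ _ [_ [/= -> /(pcan_inj (@pickleK _)) e]].
  by rewrite -(size_branch g i) -(size_branch g j) e.
exists n0 => n /avoid av; rewrite leqNgt; apply/negP => lt.
suff : set0 (pickle (branch g n)) by [].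
by rewrite -av.
Qed.

Lemma disjoint_swallowing_groupable_cover (X : topologicalType)
    (B : set (set X)) (V : nat -> set (set X)) :
  bornology B -> (forall n O, V n O -> open O) ->
  (forall n, finite_set (V n)) -> trivIset [set: nat] V ->
  eventually_swallows B V -> born_groupable_cover B (\bigcup_n V n).
Proof.
move=> hB openV finV trivV swV; split=> [O [n _ /openV]||] //; last by exists V.
rewrite -subTset => x _; have [n0 sw] := swV _ (bornology_set1 x hB).
by have [O VO xO] := sw n0 (leqnn n0); exists O; [exists n0|exact: xO].
Qed.

Lemma not_winning_for_one (X : topologicalType) (B : set (set X))
    (s : strategy (set X)) :
  bornology B -> S_fin (born_open_cover B) (born_groupable_cover B) ->
  ~ winning_for_one (born_open_cover B) (born_groupable_cover B) s.
Proof.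
move=> hB selB winS.
have exhU U : exists F, born_open_cover B U -> exhaustion B U F.
  have [/(exhaustion_exists selB)[F]|] := pselect (born_open_cover B U).
    by exists F.
  by exists (fun=> set0).
have [F FP] := choice exhU.
have exhF p : legal_position s p ->
    exhaustion B (fresh_move s p) (F (fresh_move s p)).
  move=> legp; apply: FP; apply: born_open_cover_setD => //.
    exact: finite_used legp.
  exact: (winning_for_one_move winS legp).
pose pos := position s F.
have legpos t : legal_position s (pos t).
  apply: legal_positionP => p /exhF[finF _ subF _] k.
  by split=> // O FO; apply: subF; exists k.
pose E t := F (fresh_move s (pos t)).
have exhE t : exhaustion B (fresh_move s (pos t)) (E t) by exact: exhF.
(* The codes that decode to no position are sent to the initial one, so that
   every index of the sequence carries a cover. *)
pose t_ n : seq nat := odflt [::] (unpickle n).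
have [W [WP swW]] : exists W : nat -> set (set X),
    (forall n, finite_set (W n) /\ W n `<=` \bigcup_k E (t_ n) k) /\
    eventually_swallows B W.
  by apply: S_fin_eventually_swallows => // n; case: (exhE (t_ n)).
have bound t : exists k, W (pickle t) `<=` E t k.
  have [finW subW] := WP (pickle t).
  by move: subW; rewrite /t_ pickleK; exact: exhaustion_finite_sub.
have [g gP] := choice bound.
pose V n := E (branch g n) (g (branch g n)).
have mkseqV n : mkseq V n = pos (branch g n).
  by elim: n => // n IHn; rewrite mkseqS IHn /pos /= position_rcons.
have Vfresh n : V n `<=` fresh_move s (mkseq V n).
  rewrite mkseqV => O VO; have [_ _ subE _] := exhE (branch g n).
  by apply: subE; exists (g (branch g n)).
have finV n : finite_set (V n).
  by have [finE _ _ _] := exhE (branch g n); exact: finE.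
have [|covS] := winS V; first by move=> n; split=> // O /Vfresh[].
apply; apply: disjoint_swallowing_groupable_cover => //.
- by move=> n O /Vfresh[sO _]; case: (covS n) => /(_ O sO).
- suff disj i j : (i < j)%N -> V i `&` V j = set0.
    apply/trivIsetP => i j _ _; rewrite neq_ltn => /orP[/disj|/disj] //.
    by rewrite setIC.
  move=> ij; rewrite -subset0 => O [VO /Vfresh[_]]; apply.
  by exists i; rewrite /= ?size_mkseq // nth_mkseq.
move=> A /swW[k0 sw]; have [n0 late] := branch_pickle_eventually g k0.
exists n0 => n /late/sw[O WO AO]; exists O => //.
exact: gP WO.
Qed.

(** ONE may play [U n] in round [n] without looking at TWO's answers; a play
    that TWO wins against this strategy is a selection from [U]. *)
Lemma S_fin_of_not_one_wins (T : Type) (A B : set (set T)) :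
  ~ one_wins_G_fin A B -> S_fin A B.
Proof.
move=> nwin U AU; apply: contrapT => nsel; apply: nwin.
exists (fun p => U (size p)) => V legV; split=> [n|BV].
  by rewrite /one_move; exact: AU.
apply: nsel; exists V; split=> // n.
by have := legV n; rewrite /one_move size_mkseq.
Qed.

Theorem theorem3p20 (X : topologicalType) (B : set (set X))
    (hB : bornology B) (hBase : has_closed_base B) :
  S_fin (born_open_cover B) (born_groupable_cover B) <->
  ~ one_wins_G_fin (born_open_cover B) (born_groupable_cover B).
Proof.
split=> [selB [s]|]; last exact: S_fin_of_not_one_wins.
exact: not_winning_for_one.
Qed.
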